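(* There is a natural isomorphism $\operatorname{Lie}_\circ(-)\xrightarrow{\cong}\mathcal{L}ie\circ-$ of functors $\mathbf{Op}\to\mathbf{Op}$, where $\circ$ on the right-hand side denotes the Manin white product of operads.
   Context: Operads. $\mathbf{Op}$ is the category of finitely generated binary quadratic symmetric operads in vector spaces over a field $\mathbb{K}$. An operad in $\mathbf{Op}$ is written $(\mathcal{O},\cdot_i,\bullet_j,[-,-]_k)$: it is generated by non-symmetric operations $\cdot_i$ ($1\le i\le p$), symmetric operations $\bullet_j$ ($1\le j\le q$) and anti-symmetric operations $[-,-]_k$ ($1\le k\le r$), subject to quadratic (ternary) relations. $\mathcal{L}ie$ is the operad of Lie algebras. White product. For $\mathcal{O},\mathcal{P}\in\mathbf{Op}$ the white product $\mathcal{O}\circ\mathcal{P}\in\mathbf{Op}$ is generated by $\mathcal{O}(2)\otimes\mathcal{P}(2)$ (diagonal $S_2$-action) with all ternary quadratic relations that hold in $\mathcal{O}(3)\otimes\mathcal{P}(3)$, i.e. that hold for the tensor product operations on $A\otimes V$ for all $\mathcal{O}$-algebras $A$ and $\mathcal{P}$-algebras $V$. Cochains. For a vector space $V$, $C^*(\Delta_1;V)=C^*(\Delta_1;\mathbb{K})\otimes V$ is the complex of non-degenerate cochains on the $1$-simplex $\Delta_1$ with coefficients in $V$. Its degree $0$ part consists of the elements $\lambda(x)+\rho(y)$, $x,y\in V$, where $\lambda(x)$ (resp. $\rho(x)$) is the $0$-cochain with value $x$ on the left vertex $v_l$ (resp. the right vertex $v_r$) and $0$ on the other vertex; its degree $1$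 part consists of the $1$-cochains $\sigma(x)$, $x\in V$, with value $x$ on the $1$-cell. The differential is $d\lambda(x)=-\sigma(x)$, $d\rho(x)=\sigma(x)$. For $X=v_l$, $v_r$ or $\partial\Delta_1=v_l\sqcup v_r$, $C^*(\Delta_1,X;V)$ is the subcomplex of cochains vanishing on $X$. For an operad $\mathcal{P}$, a dg $\mathcal{P}$-algebra structure on $C^*(\Delta_1;V)$ is local if each such $C^*(\Delta_1,X;V)$ is a dg $\mathcal{P}$-ideal. Cup brackets. Consider $C^*(\Delta_1;\mathbb{K})$ as a dg Lie algebra via $[-,-]=\cup-\cup^{op}$, with $\cup$ the usual cup product of cochains (over $\mathbb{K}$ with $\lambda=\lambda(1)$, $\rho=\rho(1)$, $\sigma=\sigma(1)$: $\lambda\cup\lambda=\lambda$, $\rho\cup\rho=\rho$, $\lambda\cup\sigma=\sigma=\sigma\cup\rho$, other products zero). For an $\mathcal{O}$-algebra $(V,\cdot_i,\bullet_j,[-,-]_k)$, the cup brackets on $C^*(\Delta_1;V)$ are the tensor product operations $\star_i:=[-,-]\otimes\cdot_i$ (non-symmetric), $\{-,-\}_j:=[-,-]\otimes\bullet_j$ (anti-symmetric) and $\circledast_k:=[-,-]\otimes[-,-]_k$ (symmetric). $\operatorname{Lie}_\circ$. The operad $\operatorname{Lie}_\circ(\mathcal{O})\in\mathbf{Op}$ is generated by non-symmetric operations $\star_i$, anti-symmetric operations $\{-,-\}_j$ and symmetric operations $\circledast_k$, subject to the largest set of (ternary quadratic) relations making $C^*(\Delta_1;V)$ with the cup brackets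 a local dg $\operatorname{Lie}_\circ(\mathcal{O})$-algebra for every $\mathcal{O}$-algebra $V$. *)

(* Defs.v *)
From HB Require Import structures.
From mathcomp Require Import all_boot all_order all_fingroup all_algebra.
From mathcomp Require Import boolp.
From mathcomp Require Export mxtens.

Set Implicit Arguments.
Unset Strict Implicit.
Unset Printing Implicit Defensive.

Import GRing.Theory.
Local Open Scope ring_scope.

Record category := Category {
  ob :> Type;
  hom : ob -> ob -> Type;
  idm : forall X, hom X X;
  cmp : forall X Y Z, hom X Y -> hom Y Z -> hom X Z;
  cmp1m : forall X Y (f : hom X Y), cmp (idm X) f = f;
  cmpm1 : forall X Y (f : hom X Y), cmp f (idm Y) = f;
  cmpA : forall W X Y Z (f : hom W X) (g : hom X Y) (h : hom Y Z),
    cmp f (cmp g h) = cmp (cmp f g) h }.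

Arguments hom {_} _ _.
Arguments idm {_} _.
Arguments cmp {_ _ _ _} _ _.

Record functor (C D : category) := Functor {
  fob :> C -> D;
  fmap : forall X Y : C, hom X Y -> hom (fob X) (fob Y);
  fmap1 : forall X : C, fmap (idm X) = idm (fob X);
  fmapM : forall (X Y Z : C) (f : hom X Y) (g : hom Y Z),
    fmap (cmp f g) = cmp (fmap f) (fmap g) }.

Arguments fmap {_ _} _ {_ _} _.

Definition is_iso (C : category) (X Y : C) (f : hom X Y) :=
  exists g : hom Y X, cmp f g = idm X /\ cmp g f = idm Y.

Definition is_natural (C D : category) (F G : functor C D)
    (eta : forall X : C, hom (F X) (G X)) :=
  forall (X Y : C) (f : hom X Y),
    cmp (fmap F f) (eta Y) = cmp (eta X) (fmap G f).

Definition naturally_isomorphic (C D : category) (F G : functor C D) :=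
  exists eta : forall X : C, hom (F X) (G X),
    is_natural eta /\ forall X : C, is_iso (eta X).

(* For a space of binary generators E with basis e_0, ..., e_(n-1), the arity *)
(* 3 part of the free operad on E is a sum of three copies of E (x) E, one    *)
(* for each tree shape                                                        *)
(*          (x_(c+1) . x_(c+2)) . x_c,      c in Z/3;                         *)
(* M c a b is the coefficient of the tree of shape c whose root is labelled   *)
(* by e_a and whose inner vertex is labelled by e_b.                          *)
Notation free3 K n := {ffun 'I_3 -> 'M[K]_n}.

(* A permutation s of the inputs takes shape c to shape s c; it preserves the *)
(* cyclic order of the two inner inputs when s is even, and exchanges them    *)
(* when s is odd. [tau] is the matrix of the action of the transposition on E *)
(* (row convention: e_a^op = \sum_b tau a b e_b).                             *)
Definition act3 (K : fieldType) (n : nat) (tau : 'M[K]_n) (s : 'S_3)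
    (M : free3 K n) : free3 K n :=
  [ffun c => M ((s^-1)%g c) *m (if odd_perm s then tau else 1%:M)].

Definition free3_map (K : fieldType) (m n : nat) (f : 'M[K]_(m, n))
    (M : free3 K m) : free3 K n :=
  [ffun c => f^T *m M c *m f].

Record is_S3_submodule (K : fieldType) (n : nat) (tau : 'M[K]_n)
    (R : free3 K n -> Prop) : Prop := IsS3Submodule {
  submod0 : R 0;
  submodP : forall (k : K) M N, R M -> R N -> R (k *: M + N);
  submod_act : forall (s : 'S_3) M, R M -> R (act3 tau s M) }.

(* The operad F(E)/(R), where E has basis 'I_gen; thus E is its arity 2 part  *)
(* and F(E)(3)/R its arity 3 part. A non-symmetric operation contributes two  *)
(* basis elements exchanged by [swap], a symmetric (resp. anti-symmetric)     *)
(* operation contributes one, on which [swap] is 1 (resp. -1).                *)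
Record quad_operad (K : fieldType) := QuadOperad {
  gen : nat;
  swap : 'M[K]_gen;
  swapK : swap *m swap = 1%:M;
  relator : free3 K gen -> Prop;
  relator_submod : is_S3_submodule swap relator }.

(* As the source is generated by its arity 2 part, a morphism of operads is   *)
(* the same as an equivariant map of generators which sends relators to       *)
(* relators; row a of the matrix is the image of e_a.                         *)
Record quad_hom (K : fieldType) (O P : quad_operad K) := QuadHom {
  hom_mx :> 'M[K]_(gen O, gen P);
  hom_swap : swap O *m hom_mx = hom_mx *m swap P;
  hom_relator : forall M, relator M -> relator (free3_map hom_mx M) }.

Lemma quad_hom_inj (K : fieldType) (O P : quad_operad K) (f g : quad_hom O P) :
  hom_mx f = hom_mx g -> f = g.
Proof.
case: f g => [f f1 f2] [g g1 g2] /= fg; subst g.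
by congr QuadHom; apply: Prop_irrelevance.
Qed.

Section Free3Map.
Variable K : fieldType.

Lemma free3_map1 n (M : free3 K n) : free3_map 1%:M M = M.
Proof. by apply/ffunP=> c; rewrite ffunE trmx1 mul1mx mulmx1. Qed.

Lemma free3_map_mul m n p (f : 'M[K]_(m, n)) (g : 'M[K]_(n, p)) M :
  free3_map (f *m g) M = free3_map g (free3_map f M).
Proof. by apply/ffunP=> c; rewrite !ffunE trmx_mul !mulmxA. Qed.

Lemma free3_mapP m n (f : 'M[K]_(m, n)) : linear (free3_map f).
Proof.
move=> k M N; apply/ffunP=> c.
by rewrite !ffunE mulmxDr mulmxDl -scalemxAr -scalemxAl.
Qed.

Lemma act3P n (t : 'M[K]_n) s : linear (act3 t s).
Proof.
by move=> k M N; apply/ffunP=> c; rewrite !ffunE mulmxDl -scalemxAl.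
Qed.

Lemma free3_map_act m n (f : 'M[K]_(m, n)) t t' s M :
  t *m f = f *m t' -> free3_map f (act3 t s M) = act3 t' s (free3_map f M).
Proof.
move=> tf; apply/ffunP=> c; rewrite !ffunE -!mulmxA; congr (_ *m (_ *m _)).
by case: ifP => _; rewrite ?mul1mx ?mulmx1 // mulmxA.
Qed.

Lemma free3_map0 m n (f : 'M[K]_(m, n)) : free3_map f 0 = 0.
Proof. by apply/ffunP=> c; rewrite !ffunE mulmx0 mul0mx. Qed.

Lemma act30 n (t : 'M[K]_n) s : act3 t s 0 = 0.
Proof. by apply/ffunP=> c; rewrite !ffunE mul0mx. Qed.

End Free3Map.

Section Op.
Variable K : fieldType.

Lemma quad_id_swap (O : quad_operad K) : swap O *m 1%:M = 1%:M *m swap O.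
Proof. by rewrite mulmx1 mul1mx. Qed.

Lemma quad_id_relator (O : quad_operad K) (M : free3 K (gen O)) :
  relator M -> relator (free3_map 1%:M M).
Proof. by rewrite free3_map1. Qed.

Definition quad_id (O : quad_operad K) : quad_hom O O :=
  QuadHom (quad_id_swap O) (@quad_id_relator O).

Lemma quad_cmp_swap (O P Q : quad_operad K)
    (f : quad_hom O P) (g : quad_hom P Q) :
  swap O *m (f *m g) = (f *m g) *m swap Q.
Proof. by rewrite mulmxA hom_swap -!mulmxA hom_swap. Qed.

Lemma quad_cmp_relator (O P Q : quad_operad K)
    (f : quad_hom O P) (g : quad_hom P Q) (M : free3 K (gen O)) :
  relator M -> relator (free3_map (f *m g) M).
Proof. by move=> RM; rewrite free3_map_mul; do 2!apply: hom_relator. Qed.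

Definition quad_cmp (O P Q : quad_operad K)
    (f : quad_hom O P) (g : quad_hom P Q) : quad_hom O Q :=
  QuadHom (quad_cmp_swap f g) (quad_cmp_relator f g).

Definition Op : category.
Proof.
refine (@Category (quad_operad K) (@quad_hom K) quad_id quad_cmp _ _ _).
- by move=> X Y f; apply: quad_hom_inj; rewrite /= mul1mx.
- by move=> X Y f; apply: quad_hom_inj; rewrite /= mulmx1.
- by move=> W X Y Z f g h; apply: quad_hom_inj; rewrite /= mulmxA.
Defined.

End Op.

Section Lie.
Variable K : fieldType.

(* [[x1,x2],x0] + [[x2,x0],x1] + [[x0,x1],x2] *)
Definition jacobi : free3 K 1 := [ffun=> 1%:M].

Definition lie_relator (M : free3 K 1) := exists k : K, M = k *: jacobi.

Lemma lie_swapK : (- 1%:M : 'M[K]_1) *m (- 1%:M) = 1%:M.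
Proof. by rewrite mulNmx mul1mx opprK. Qed.

Lemma lie_relator_submod : is_S3_submodule (- 1%:M) lie_relator.
Proof.
split.
- by exists 0; rewrite scale0r.
- by move=> k _ _ [l ->] [m ->]; exists (k * l + m); rewrite scalerDl scalerA.
- move=> s _ [k ->]; exists (k * (-1) ^+ s); apply/ffunP=> c.
  rewrite !ffunE -scalemxAl mul1mx -scalerA; congr (_ *: _).
  by case: odd_perm; rewrite ?expr1 ?expr0 ?scale1r ?scaleN1r.
Qed.

Definition Lie : Op K := QuadOperad lie_swapK lie_relator_submod.

End Lie.

(* F(E)(3) (x) F(E')(3), where E and E' have bases 'I_m and 'I_n: the entry   *)
(* of index (a,a'), (b,b') of T (c, c') is the coefficient of                 *)
(* (c; a, b) (x) (c'; a', b').                                                *)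
Notation tens33 K m n := {ffun 'I_3 * 'I_3 -> 'M[K]_(m * n)}.

Definition pure33 (K : fieldType) (m n : nat) (u : free3 K m) (v : free3 K n) :
    tens33 K m n :=
  [ffun cc => u cc.1 *t v cc.2].

(* The map F(E (x) E')(3) -> F(E)(3) (x) F(E')(3) which sends a tree labelled *)
(* by pure tensors to the tensor product of the two labelled trees.           *)
Definition diag33 (K : fieldType) (m n : nat) (M : free3 K (m * n)) :
    tens33 K m n :=
  [ffun cc => if cc.1 == cc.2 then M cc.1 else 0].

(* T is zero in O(3) (x) P(3) = (F(E)(3) / R) (x) (F(E')(3) / R'), that is,   *)
(* T belongs to R (x) F(E')(3) + F(E)(3) (x) R'.                              *)
Definition zero_in_tensor (K : fieldType) (O P : quad_operad K)
    (T : tens33 K (gen O) (gen P)) : Prop :=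
  exists s : seq (free3 K (gen O) * free3 K (gen P)),
    (forall uv, uv \in s -> relator uv.1 \/ relator uv.2) /\
    T = \sum_(uv <- s) pure33 uv.1 uv.2.

Definition white_relator (K : fieldType) (O P : quad_operad K)
    (M : free3 K (gen O * gen P)) : Prop :=
  zero_in_tensor (O := O) (P := P) (diag33 M).

Arguments white_relator {K} O P M.

Section WhiteProduct.
Variable K : fieldType.

Lemma tens1mx1 m n : (1%:M : 'M[K]_m) *t (1%:M : 'M[K]_n) = 1%:M.
Proof.
apply/matrixP=> i j.
case: (mxtens_indexP i) => i0 i1; case: (mxtens_indexP j) => j0 j1.
rewrite tensmxE !mxE (can_eq (@mxtens_indexK _ _)) xpair_eqE.
by case: eqP; case: eqP; rewrite ?mulr1 ?mul0r ?mulr0.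
Qed.

Lemma white_swapK (O P : quad_operad K) :
  (swap O *t swap P) *m (swap O *t swap P) = 1%:M.
Proof. by rewrite tensmx_mul !swapK tens1mx1. Qed.

Lemma tensmxZl m n p q (k : K) (A : 'M_(m, n)) (B : 'M_(p, q)) :
  (k *: A) *t B = k *: (A *t B).
Proof. by apply/matrixP=> i j; rewrite !mxE mulrA. Qed.

Lemma white_relator_submod (O P : quad_operad K) :
  is_S3_submodule (swap O *t swap P) (white_relator O P).
Proof.
split.
- exists [::]; split=> //; rewrite big_nil.
  by apply/ffunP=> cc; rewrite !ffunE if_same.
- move=> k M N [s [sR Ms]] [t [tR Nt]].
  exists ([seq (k *: uv.1, uv.2) | uv <- s] ++ t); split.
    move=> uv; rewrite mem_cat => /orP[/mapP[w ws ->]|/tR //] /=.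
    case: (sR _ ws) => [Rw|]; [left | by right].
    have hP := submodP (relator_submod O); have h0 := submod0 (relator_submod O).
    by have := hP k _ _ Rw h0; rewrite addr0.
  transitivity (k *: diag33 M + diag33 N).
    by apply/ffunP=> cc; rewrite !ffunE; case: eqP; rewrite ?scaler0 ?addr0.
  rewrite Ms Nt big_cat big_map scaler_sumr /=; congr (_ + _).
  by apply: eq_bigr=> uv _; apply/ffunP=> cc; rewrite !ffunE tensmxZl.
- move=> s M [t [tR Mt]].
  pose a1 := act3 (swap O) s; pose a2 := act3 (swap P) s.
  exists [seq (a1 uv.1, a2 uv.2) | uv <- t]; split.
    move=> _ /mapP[uv uvt ->] /=; case: (tR _ uvt) => R; [left | right];
    exact: (submod_act (relator_submod _)).
  pose tt := swap O *t swap P.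
  pose A (T : tens33 K (gen O) (gen P)) : tens33 K (gen O) (gen P) :=
    [ffun cc => T ((s^-1)%g cc.1, (s^-1)%g cc.2)
                *m (if odd_perm s then tt else 1%:M)].
  transitivity (A (diag33 M)).
    apply/ffunP=> cc; rewrite !ffunE /= (inj_eq perm_inj).
    by case: eqP => _; rewrite ?mul0mx.
  rewrite Mt big_map; apply/ffunP=> cc.
  rewrite ffunE !sum_ffunE mulmx_suml; apply: eq_bigr => uv _.
  rewrite !ffunE -[RHS]/(_ *t _) -tensmx_mul; congr (_ *m _).
  by case: odd_perm; rewrite // tens1mx1.
Qed.

Definition white (O P : Op K) : Op K :=
  QuadOperad (white_swapK O P) (white_relator_submod O P).

Section Map.
Variables (O O' P P' : Op K) (f : quad_hom O O') (g : quad_hom P P').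

Lemma white_map_swap :
  swap (white O P) *m (f *t g) = (f *t g) *m swap (white O' P').
Proof. by rewrite /= !tensmx_mul !hom_swap. Qed.

Lemma white_map_relator (M : free3 K (gen (white O P))) :
  relator M -> relator (q := white O' P') (free3_map (f *t g) M).
Proof.
move=> /= [s [sR Ms]].
exists [seq (free3_map f uv.1, free3_map g uv.2) | uv <- s]; split.
  move=> _ /mapP[uv uvs ->] /=.
  by case: (sR _ uvs) => R; [left | right]; apply: hom_relator.
pose F (T : tens33 K (gen O) (gen P)) : tens33 K (gen O') (gen P') :=
  [ffun cc => (f *t g)^T *m T cc *m (f *t g)].
transitivity (F (diag33 M)).
  by apply/ffunP=> cc; rewrite !ffunE; case: eqP; rewrite ?mulmx0 ?mul0mx.
rewrite Ms big_map; apply/ffunP=> cc.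
rewrite ffunE !sum_ffunE mulmx_sumr mulmx_suml; apply: eq_bigr=> uv _.
by rewrite !ffunE trmx_tens !tensmx_mul.
Qed.

Definition white_map : @hom (Op K) (white O P) (white O' P') :=
  @QuadHom K (white O P) (white O' P') (f *t g)
    white_map_swap white_map_relator.
End Map.

Definition white_functor (O : Op K) : functor (Op K) (Op K).
Proof.
refine (@Functor (Op K) (Op K) (white O)
  (fun P Q g => white_map (quad_id O) g) _ _).
- by move=> P; apply: quad_hom_inj; rewrite /= tens1mx1.
- by move=> P Q S g h; apply: quad_hom_inj; rewrite /= tensmx_mul mul1mx.
Defined.

End WhiteProduct.

(* Koszul sign of the permutation (x0,x1,x2) |-> (x_(c+1), x_(c+2), x_c) of   *)
(* homogeneous elements of degrees deg 0, deg 1, deg 2.                       *)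
Definition koszul (K : fieldType) (deg : 'I_3 -> nat) (c : 'I_3) : K :=
  let d0 := deg 0 in let d1 := deg 1 in let d2 := deg 2 in
  (-1) ^+ (if c == 0 then (d0 * (d1 + d2))%N
           else if c == 1 then (d2 * (d0 + d1))%N else 0%N).

(* The value of M at homogeneous elements x 0, x 1, x 2 of degrees [deg],     *)
(* where e_a operates as [op a].                                              *)
Definition eval3 (K : fieldType) (n : nat) (A : lmodType K)
    (op : 'I_n -> A -> A -> A) (deg : 'I_3 -> nat) (M : free3 K n)
    (x : 'I_3 -> A) : A :=
  \sum_(c < 3) koszul K deg c *:
    \sum_(a < n) \sum_(b < n)
      M c a b *: op a (op b (x (c + 1)) (x (c + 2))) (x c).

Record is_bilinear (K : fieldType) (A : lmodType K) (m : A -> A -> A) : Prop :=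
  IsBilinear {
    bilin_l : forall y, linear (m^~ y);
    bilin_r : forall x, linear (m x) }.

Record is_algebra (K : fieldType) (O : quad_operad K) (V : lmodType K)
    (op : 'I_(gen O) -> V -> V -> V) : Prop := IsAlgebra {
  alg_bilin : forall a, is_bilinear (op a);
  alg_swap : forall a x y, op a y x = \sum_b swap O a b *: op b x y;
  alg_rel : forall M, relator M -> forall x, eval3 op (fun=> 0%N) M x = 0 }.

Arguments is_algebra {K} O {V} op.

(* Non-negatively graded cochain complexes; [cc_proj i] is the projection of  *)
(* the total space onto its component of degree i.                            *)
Record cochain_complex (K : fieldType) := CochainComplex {
  cc_sort :> lmodType K;
  cc_proj : nat -> cc_sort -> cc_sort;
  cc_proj_linear : forall i, linear (cc_proj i);
  cc_projK : forall i j x,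
    cc_proj i (cc_proj j x) = if i == j then cc_proj i x else 0;
  cc_proj_sum : forall x, exists N, x = \sum_(i < N) cc_proj i x;
  cc_d : cc_sort -> cc_sort;
  cc_d_linear : linear cc_d;
  cc_d_deg : forall i x, cc_d (cc_proj i x) = cc_proj i.+1 (cc_d x);
  cc_d_sq : forall x, cc_d (cc_d x) = 0 }.

Definition homog (K : fieldType) (A : cochain_complex K) (i : nat) (x : A) :=
  cc_proj i x = x.

Record is_dg_algebra (K : fieldType) (O : quad_operad K)
    (A : cochain_complex K) (op : 'I_(gen O) -> A -> A -> A) : Prop :=
  IsDgAlgebra {
    dg_bilin : forall a, is_bilinear (op a);
    dg_deg : forall a i j x y,
      homog i x -> homog j y -> homog (i + j) (op a x y);
    dg_swap : forall a i j x y, homog i x -> homog j y ->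
      (-1) ^+ (i * j) *: op a y x = \sum_b swap O a b *: op b x y;
    dg_leibniz : forall a i x y, homog i x ->
      cc_d (op a x y) = op a (cc_d x) y + (-1) ^+ i *: op a x (cc_d y);
    dg_rel : forall M, relator M -> forall deg x,
      (forall c, homog (deg c) (x c)) -> eval3 op deg M x = 0 }.

Arguments is_dg_algebra {K} O {A} op.

Record is_dg_ideal (K : fieldType) (n : nat) (A : cochain_complex K)
    (op : 'I_n -> A -> A -> A) (J : A -> Prop) : Prop := IsDgIdeal {
  ideal0 : J 0;
  ideal_lin : forall (k : K) x y, J x -> J y -> J (k *: x + y);
  ideal_proj : forall i x, J x -> J (cc_proj i x);
  ideal_d : forall x, J x -> J (cc_d x);
  ideal_opl : forall a x y, J x -> J (op a x y);
  ideal_opr : forall a x y, J y -> J (op a x y) }.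

Inductive cell := VLeft | VRight | Edge.

Definition cell_code (c : cell) : 'I_3 :=
  match c with VLeft => 0 | VRight => 1 | Edge => 2 end.
Definition cell_decode (i : 'I_3) : cell :=
  if i == 0 then VLeft else if i == 1 then VRight else Edge.
Lemma cell_codeK : cancel cell_code cell_decode. Proof. by case. Qed.
HB.instance Definition _ := Finite.copy cell (can_type cell_codeK).

Definition cell_dim (c : cell) : nat := if c is Edge then 1%N else 0%N.

(* lambda(x), rho(x) and sigma(x) are the functions with value x at VLeft,    *)
(* VRight and Edge, respectively, and 0 elsewhere.                            *)
Notation cochain V := {ffun cell -> V}.

Section Cochains.
Variables (K : fieldType) (V : lmodType K).

Definition coch_proj (i : nat) (f : cochain V) : cochain V :=
  [ffun c => if cell_dim c == i then f c else 0].

Definition coch_d (f : cochain V) : cochain V :=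
  [ffun c => if c is Edge then f VRight - f VLeft else 0].

Lemma coch_proj_linear i : linear (coch_proj i).
Proof.
by move=> k f g; apply/ffunP=> c; rewrite !ffunE; case: eqP; rewrite ?scaler0 ?addr0.
Qed.

Lemma coch_projK i j f :
  coch_proj i (coch_proj j f) = if i == j then coch_proj i f else 0.
Proof.
apply/ffunP=> c; case: (eqVneq i j) => [->|ij]; rewrite !ffunE.
  by case: (_ == j).
by case: (eqVneq (cell_dim c) i) => // ->; rewrite (negPf ij).
Qed.

Lemma coch_proj_sum f : exists N, f = \sum_(i < N) coch_proj i f.
Proof.
exists 2; apply/ffunP=> c; rewrite sum_ffunE 2!big_ord_recl big_ord0 !ffunE /=.
by case: c; rewrite /= ?addr0 ?add0r.
Qed.

Lemma coch_d_linear : linear coch_d.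
Proof.
move=> k f g; apply/ffunP=> -[]; rewrite !ffunE ?scaler0 ?addr0 //.
by rewrite scalerBr opprD addrACA.
Qed.

Lemma coch_d_deg i f : coch_d (coch_proj i f) = coch_proj i.+1 (coch_d f).
Proof.
by apply/ffunP=> -[]; rewrite !ffunE //= eqSS; case: eqP; rewrite ?subrr.
Qed.

Lemma coch_d_sq f : coch_d (coch_d f) = 0.
Proof. by apply/ffunP=> -[]; rewrite !ffunE ?subrr. Qed.

Definition cochains : cochain_complex K :=
  CochainComplex coch_proj_linear coch_projK coch_proj_sum
    coch_d_linear coch_d_deg coch_d_sq.

(* C^*(Delta_1, X; V) *)
Definition vanishing_on (X : seq cell) (f : cochains) : Prop :=
  forall c, c \in X -> (f : cochain V) c = 0.

Definition is_local_dg_algebra (O : quad_operad K)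
    (op : 'I_(gen O) -> cochains -> cochains -> cochains) : Prop :=
  is_dg_algebra O op /\
  forall X, X \in [:: [:: VLeft]; [:: VRight]; [:: VLeft; VRight]] ->
    is_dg_ideal op (vanishing_on X).

(* The coefficient of the basis cochain r in the cup product of the basis     *)
(* cochains p and q.                                                          *)
Definition cup (p q r : cell) : K :=
  match p, q, r with
  | VLeft, VLeft, VLeft | VRight, VRight, VRight
  | VLeft, Edge, Edge | Edge, VRight, Edge => 1
  | _, _, _ => 0
  end.

Definition cup_bracket (p q r : cell) : K :=
  cup p q r - (-1) ^+ (cell_dim p * cell_dim q) * cup q p r.

Definition tensor_cup_bracket (m : V -> V -> V) (f g : cochains) : cochains :=
  [ffun r => \sum_(p : cell) \sum_(q : cell)
     cup_bracket p q r *: m ((f : cochain V) p) ((g : cochain V) q)].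

Definition cup_brackets (n : nat) (op : 'I_n -> V -> V -> V) :
    'I_n -> cochains -> cochains -> cochains :=
  fun a => tensor_cup_bracket (op a).

End Cochains.

Arguments is_local_dg_algebra {K V} O op.

Section LieCirc.
Variable K : fieldType.

Lemma lie_circ_swapK (O : quad_operad K) : (- swap O) *m (- swap O) = 1%:M.
Proof. by rewrite mulNmx mulmxN opprK swapK. Qed.

(* The cup bracket of a symmetric operation is anti-symmetric and vice versa, *)
(* whence the sign in front of [swap O].                                      *)
Definition lie_circ_with (O : quad_operad K) (R : free3 K (gen O) -> Prop)
    (hR : is_S3_submodule (- swap O) R) : quad_operad K :=
  QuadOperad (lie_circ_swapK O) hR.

Definition cup_admissible (O : quad_operad K) (R : free3 K (gen O) -> Prop)
    (hR : is_S3_submodule (- swap O) R) : Prop :=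
  forall (V : lmodType K) (op : 'I_(gen O) -> V -> V -> V),
    is_algebra O op -> is_local_dg_algebra (lie_circ_with hR) (cup_brackets op).

(* The largest admissible set of relations, as the union of all of them; it   *)
(* is an S_3-submodule by [lie_circ_relator_submod] and is admissible by      *)
(* [lie_circ_admissible].                                                     *)
Definition lie_circ_relator (O : quad_operad K) (M : free3 K (gen O)) : Prop :=
  exists (R : free3 K (gen O) -> Prop) (hR : is_S3_submodule (- swap O) R),
    cup_admissible hR /\ R M.

Arguments lie_circ_relator O M : clear implicits.

Lemma sum_cell (W : nmodType) (F : cell -> W) :
  \sum_(c : cell) F c = F VLeft + F VRight + F Edge.
Proof.
have decK : cancel cell_decode cell_code.
  by move=> i; apply: val_inj; case: i => [[|[|[|]]]].
rewrite (reindex cell_decode) /=; last first.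
  by exists cell_code => c _; [apply: decK | apply: cell_codeK].
by rewrite 3!big_ord_recl big_ord0 addr0 addrA.
Qed.

Lemma cup_bracketE (V : lmodType K) (m : V -> V -> V) (f g : cochain V) :
  tensor_cup_bracket m f g =
  [ffun r => if r is Edge then
     m (f VLeft) (g Edge) - m (f Edge) (g VLeft)
     + m (f Edge) (g VRight) - m (f VRight) (g Edge) else 0].
Proof.
apply/ffunP=> r; rewrite !ffunE !sum_cell /cup_bracket.
case: r; rewrite /= !(mul0n, muln0, mul1n) ?expr0 ?expr1 ?mul1r ?mulr1 ?mulr0;
  rewrite ?subrr ?subr0 ?sub0r ?scale0r ?scaleN1r ?scale1r ?oppr0 ?scale0r.
- by rewrite !addr0.
- by rewrite !addr0.
rewrite ?add0r ?addr0.
by rewrite addrAC !addrA.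
Qed.

Lemma bilin0l (A : lmodType K) (m : A -> A -> A) y :
  is_bilinear m -> m 0 y = 0.
Proof. by case=> h _; have := h y (-1) 0 0; rewrite scaler0 addr0 scaleN1r addNr. Qed.

Lemma bilin0r (A : lmodType K) (m : A -> A -> A) x :
  is_bilinear m -> m x 0 = 0.
Proof. by case=> _ h; have := h x (-1) 0 0; rewrite scaler0 addr0 scaleN1r addNr. Qed.

Lemma bilinBl (A : lmodType K) (m : A -> A -> A) x x' y :
  is_bilinear m -> m (x - x') y = m x y - m x' y.
Proof. by case=> h _; have := h y (-1) x' x; rewrite !scaleN1r !(addrC (- _)). Qed.

Lemma bilinBr (A : lmodType K) (m : A -> A -> A) x y y' :
  is_bilinear m -> m x (y - y') = m x y - m x y'.
Proof. by case=> _ h; have := h x (-1) y' y; rewrite !scaleN1r !(addrC (- _)). Qed.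

Lemma cup_addACA (V : zmodType) (a b c d a' b' c' d' : V) :
  (a + a') - (b + b') + (c + c') - (d + d') =
  (a - b + c - d) + (a' - b' + c' - d').
Proof.
rewrite [RHS]addrACA -opprD; congr (_ - _).
by rewrite [RHS]addrACA; congr (_ + _); rewrite [RHS]addrACA -opprD.
Qed.

Lemma homogE (V : lmodType K) i (f : cochains V) :
  homog i f <-> forall c, cell_dim c != i -> (f : cochain V) c = 0.
Proof.
split=> [<- c /negPf ci | h]; first by rewrite ffunE ci.
by apply/ffunP=> c; rewrite ffunE; case: (eqVneq (cell_dim c) i) => // /h.
Qed.

Section CupBrackets.
Variables (O : quad_operad K) (V : lmodType K).
Variable op : 'I_(gen O) -> V -> V -> V.
Hypothesis opP : is_algebra O op.

Let opB a := alg_bilin opP a.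

Lemma cup_bilin a : is_bilinear (A := cochains V) (cup_brackets op a).
Proof.
have [hl hr] := opB a.
split=> [g|f] k x y; rewrite /cup_brackets /= !cup_bracketE;
  apply/ffunP=> -[]; rewrite !ffunE ?scaler0 ?addr0 //.
- by rewrite !hl cup_addACA !scalerDr !scalerN.
- by rewrite !hr cup_addACA !scalerDr !scalerN.
Qed.

Lemma cup_deg a i j (f g : cochains V) : homog i f -> homog j g ->
  homog (i + j) (cup_brackets op a f g : cochains V).
Proof.
move=> /homogE hf /homogE hg; apply/homogE=> c.
rewrite /cup_brackets cup_bracketE ffunE; case: c => //= ij.
case: i hf ij => [|[|i]] hf ij.
- have ge : g Edge = 0 by apply: hg.
  rewrite (hf Edge) // ge.
  by rewrite !(bilin0l _ (opB _)) !(bilin0r _ (opB _)) !(subr0, addr0).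
- have gl : g VLeft = 0 by apply: hg; case: j ij.
  have gr : g VRight = 0 by apply: hg; case: j ij.
  rewrite (hf VLeft) // (hf VRight) // gl gr.
  by rewrite !(bilin0l _ (opB _)) !(bilin0r _ (opB _)) !(subr0, addr0).
- rewrite (hf VLeft) // (hf VRight) // (hf Edge) //.
  by rewrite !(bilin0l _ (opB _)) !(subr0, addr0).
Qed.

Lemma cup_swap a i j (f g : cochains V) : homog i f -> homog j g ->
  (-1) ^+ (i * j) *: (cup_brackets op a g f : cochains V) =
  \sum_b (- swap O) a b *: (cup_brackets op b f g : cochains V).
Proof.
move=> /homogE hf /homogE hg; apply/ffunP=> c.
rewrite /cup_brackets sum_ffunE ffunE cup_bracketE ffunE.
under eq_bigr => b _ do rewrite ffunE cup_bracketE ffunE mxE scaleNr.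
case: c; last rewrite sumrN; try by
  rewrite scaler0 big1 // => b _; rewrite scaler0 oppr0.
have -> : \sum_b swap O a b *: (op b (f VLeft) (g Edge) -
    op b (f Edge) (g VLeft) + op b (f Edge) (g VRight) -
    op b (f VRight) (g Edge)) =
    op a (g Edge) (f VLeft) - op a (g VLeft) (f Edge) +
    op a (g VRight) (f Edge) - op a (g Edge) (f VRight).
  rewrite !(alg_swap opP a) -!sumrN -!big_split /=; apply: eq_bigr => b _.
  by rewrite !scalerDr !scalerN.
have [i0|i0] := eqVneq i 0%N; last first.
  have fl : f VLeft = 0 by apply: hf; rewrite eq_sym.
  have fr : f VRight = 0 by apply: hf; rewrite eq_sym.
  rewrite fl fr.
  rewrite !(bilin0r _ (opB _)).
  have [->|j0] := eqVneq j 0%N; last first.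
    have gl : g VLeft = 0 by apply: hg; rewrite eq_sym.
    have gr : g VRight = 0 by apply: hg; rewrite eq_sym.
    by rewrite gl gr !(bilin0l _ (opB _))
       !(subr0, addr0, sub0r, oppr0, scaler0).
  rewrite muln0 scale1r !(subr0, sub0r, addr0, add0r).
  by rewrite opprD opprK.
have fe : f Edge = 0 by apply: hf; rewrite i0.
rewrite i0 mul0n scale1r !opprD !opprK fe !(bilin0r _ (opB _)).
by rewrite !(subr0, sub0r, addr0, add0r, oppr0) addrC.
Qed.

Lemma cup_leibniz a i (f g : cochains V) : homog i f ->
  cc_d (cup_brackets op a f g : cochains V) =
  (cup_brackets op a (cc_d f) g : cochains V) +
  (-1) ^+ i *: (cup_brackets op a f (cc_d g) : cochains V).
Proof.
move=> /homogE hf; rewrite /= /cup_brackets !cup_bracketE.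
apply/ffunP=> -[]; rewrite !ffunE ?scaler0 ?addr0 //.
rewrite !(bilin0l _ (opB _)) !(bilin0r _ (opB _)) !(subr0, sub0r, addr0, add0r, oppr0).
case: i hf => [|i] hf; last first.
  by rewrite (hf VLeft) // (hf VRight) // subrr !(bilin0l _ (opB _))
     !(subr0, sub0r, addr0, add0r, oppr0, scaler0).
rewrite scale1r (addrC (- _)) -(bilinBr _ _ _ (opB _)) (bilinBl _ _ _ (opB _)).
by rewrite addrA subrK subrr.
Qed.

Lemma cup_ideal X : X \in [:: [:: VLeft]; [:: VRight]; [:: VLeft; VRight]] ->
  is_dg_ideal (A := cochains V) (cup_brackets op) (@vanishing_on K V X).
Proof.
move=> hX.
have XE c : c \in X -> c != Edge.
  by move: hX; rewrite !inE => /or3P[] /eqP->; rewrite !inE;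
     [move/eqP-> | move/eqP-> | case/orP=> /eqP->].
have vE (h : cochains V) :
    (forall c, c != Edge -> (h : cochain V) c = 0) -> vanishing_on X h.
  by move=> hh c /XE /hh.
split.
- by move=> c _; rewrite ffunE.
- by move=> k f g hf hg c cX; rewrite !ffunE hf // hg // scaler0 addr0.
- by move=> i f hf c cX; rewrite ffunE hf // if_same.
- by move=> f _; apply: vE => -[] //; rewrite ffunE.
- by move=> a f g _; apply: vE => -[] //; rewrite /cup_brackets cup_bracketE ffunE.
- by move=> a f g _; apply: vE => -[] //; rewrite /cup_brackets cup_bracketE ffunE.
Qed.

Lemma cup_local_dg (R : free3 K (gen O) -> Prop)
    (hR : is_S3_submodule (- swap O) R) :
  (forall M, R M -> forall deg (x : 'I_3 -> cochains V),
     (forall c, homog (deg c) (x c)) -> eval3 (cup_brackets op) deg M x = 0) ->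
  is_local_dg_algebra (V := V) (lie_circ_with hR) (cup_brackets op).
Proof.
move=> RV; split; last exact: cup_ideal.
split=> //=; first exact: cup_bilin; first exact: cup_deg.
- exact: cup_swap.
- exact: cup_leibniz.
Qed.

End CupBrackets.

Lemma eval3_linear n (A : lmodType K) (op : 'I_n -> A -> A -> A) deg x k
    (M N : free3 K n) :
  eval3 op deg (k *: M + N) x = k *: eval3 op deg M x + eval3 op deg N x.
Proof.
rewrite /eval3 scaler_sumr -big_split /=; apply: eq_bigr => c _.
rewrite scalerA [k * _]mulrC -scalerA -scalerDr; congr (_ *: _).
rewrite scaler_sumr -big_split /=; apply: eq_bigr => a _.
rewrite scaler_sumr -big_split /=; apply: eq_bigr => b _.
by rewrite !ffunE !mxE scalerDl scalerA.
Qed.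

Lemma eval30 n (A : lmodType K) (op : 'I_n -> A -> A -> A) deg x :
  eval3 op deg (0 : free3 K n) x = 0.
Proof. by have := eval3_linear op deg x (-1) 0 0; rewrite scaler0 addr0 scaleN1r addNr. Qed.

Lemma lie_circ_relatorP (O : quad_operad K) (R : free3 K (gen O) -> Prop)
    (hR : is_S3_submodule (- swap O) R) :
  cup_admissible hR -> forall M, R M -> lie_circ_relator O M.
Proof. by move=> aR M RM; exists R, hR. Qed.

Lemma lie_circ_relator_submod (O : quad_operad K) :
  is_S3_submodule (- swap O) (lie_circ_relator O).
Proof.
split.
- have h0 : is_S3_submodule (- swap O) (fun M : free3 K (gen O) => M = 0).
    by split=> [|k M N -> ->|s M ->] //; rewrite ?scaler0 ?addr0 ?act30.
  exists _, h0; split=> // V op opP; apply: cup_local_dg => // M -> deg x _.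
  exact: eval30.
- move=> k M N [R [hR [aR RM]]] [S [hS [aS SN]]].
  pose T (P : free3 K (gen O)) := exists A B, [/\ R A, S B & P = A + B].
  have hT : is_S3_submodule (- swap O) T.
    split.
    + by exists 0, 0; split; rewrite ?addr0 //; apply: submod0; eassumption.
    + move=> l _ _ [A [B [RA SB ->]]] [A' [B' [RA' SB' ->]]].
      exists (l *: A + A'), (l *: B + B').
      by split; [apply: (submodP hR) | apply: (submodP hS) |];
         rewrite // scalerDr addrACA.
    + move=> s _ [A [B [RA SB ->]]].
      exists (act3 (- swap O) s A), (act3 (- swap O) s B).
      split; [exact: (submod_act hR) | exact: (submod_act hS) |].
      by have := act3P (- swap O) s 1 A B; rewrite !scale1r.
  exists T, hT; split.
    move=> V op opP; apply: cup_local_dg => // _ [A [B [RA SB ->]]] deg x hx.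
    have [dR _] := aR V op opP; have [dS _] := aS V op opP.
    rewrite -[A]scale1r eval3_linear.
    by rewrite (dg_rel dR RA hx) (dg_rel dS SB hx) scaler0 addr0.
  exists (k *: M), N; split=> //.
  by have := submodP hR k RM (submod0 hR); rewrite addr0.
- by move=> s M [R [hR [aR RM]]]; exists R, hR; split=> //; apply: submod_act.
Qed.

Lemma lie_circ_admissible (O : quad_operad K) :
  cup_admissible (lie_circ_relator_submod O).
Proof.
move=> V op opP; apply: cup_local_dg => // M [R [hR [aR RM]]] deg x hx.
by have [dR _] := aR V op opP; apply: (dg_rel dR).
Qed.

Definition lie_circ (O : Op K) : Op K :=
  lie_circ_with (lie_circ_relator_submod O).

Definition pullback_op (m n : nat) (f : 'M[K]_(m, n)) (A : lmodType K)
    (op : 'I_n -> A -> A -> A) : 'I_m -> A -> A -> A :=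
  fun a x y => \sum_b f a b *: op b x y.

Lemma pullback_bilin m n (f : 'M[K]_(m, n)) (A : lmodType K)
    (op : 'I_n -> A -> A -> A) :
  (forall b, is_bilinear (op b)) -> forall a, is_bilinear (pullback_op f op a).
Proof.
move=> opB a; split=> z k x y; rewrite /pullback_op scaler_sumr -big_split /=;
  apply: eq_bigr => b _; have [hl hr] := opB b;
  by rewrite ?hl ?hr scalerDr !scalerA mulrC.
Qed.

Lemma eval3_pullback m n (f : 'M[K]_(m, n)) (A : lmodType K)
    (op : 'I_n -> A -> A -> A) deg M x :
  (forall b, is_bilinear (op b)) ->
  eval3 (pullback_op f op) deg M x = eval3 op deg (free3_map f M) x.
Proof.
move=> opB; apply: eq_bigr => c _; congr (_ *: _).
have sumZ b y (k : 'I_n -> K) (G : 'I_n -> A) :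
    op b (\sum_i k i *: G i) y = \sum_i k i *: op b (G i) y.
  have [hl _] := opB b.
  elim/big_rec2: _ => [|i u v _ <-]; last by rewrite hl.
  exact: bilin0l.
rewrite /pullback_op.
transitivity (\sum_(a' < n) \sum_(b' < n) \sum_(b < m) \sum_(a < m)
    (f a a' * M c a b * f b b') *: op a' (op b' (x (c + 1)) (x (c + 2))) (x c)).
  transitivity (\sum_(a < m) \sum_(b < m) \sum_(a' < n) \sum_(b' < n)
    (f a a' * M c a b * f b b') *: op a' (op b' (x (c + 1)) (x (c + 2))) (x c)).
    apply: eq_bigr => a _; apply: eq_bigr => b _.
    rewrite scaler_sumr; apply: eq_bigr => a' _.
    rewrite sumZ !scaler_sumr; apply: eq_bigr => b' _.
    by rewrite !scalerA [M c a b * _]mulrC.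
  under eq_bigr => a _ do rewrite exchange_big /=.
  rewrite exchange_big /=; apply: eq_bigr => a' _.
  under eq_bigr => a _ do rewrite exchange_big /=.
  rewrite exchange_big /=; apply: eq_bigr => b' _.
  by rewrite exchange_big.
apply: eq_bigr => a' _; apply: eq_bigr => b' _.
rewrite ffunE mxE scaler_suml; apply: eq_bigr => b _.
rewrite mxE mulr_suml scaler_suml; apply: eq_bigr => a _.
by rewrite mxE.
Qed.

Lemma pullback_algebra (O P : quad_operad K) (f : quad_hom O P)
    (V : lmodType K) (op : 'I_(gen P) -> V -> V -> V) :
  is_algebra P op -> is_algebra O (pullback_op f op).
Proof.
move=> opP; have opB := alg_bilin opP; split.
- exact: pullback_bilin.
- move=> a x y; rewrite /pullback_op.
  transitivity (\sum_c (f *m swap P) a c *: op c x y).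
    under eq_bigr => b _ do rewrite (alg_swap opP) scaler_sumr.
    rewrite exchange_big; apply: eq_bigr => c _.
    by rewrite mxE scaler_suml; apply: eq_bigr => b _; rewrite scalerA.
  rewrite -hom_swap; under [RHS]eq_bigr => b _ do rewrite scaler_sumr.
  rewrite exchange_big; apply: eq_bigr => c _.
  by rewrite mxE scaler_suml; apply: eq_bigr => b _; rewrite scalerA.
- move=> M RM x; rewrite eval3_pullback //.
  by apply: (alg_rel opP); apply: hom_relator.
Qed.

Lemma cup_pullback m n (f : 'M[K]_(m, n)) (V : lmodType K)
    (op : 'I_n -> V -> V -> V) a (x y : cochains V) :
  cup_brackets (pullback_op f op) a x y =
  pullback_op (A := cochains V) f (cup_brackets op) a x y.
Proof.
apply/ffunP=> r; rewrite /cup_brackets /pullback_op sum_ffunE ffunE.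
under [RHS]eq_bigr => b _ do rewrite !ffunE scaler_sumr.
rewrite [RHS]exchange_big /=; apply: eq_bigr => p _.
under [RHS]eq_bigr => b _ do rewrite scaler_sumr.
rewrite [RHS]exchange_big /=; apply: eq_bigr => q _.
by rewrite scaler_sumr; apply: eq_bigr => b _; rewrite !scalerA mulrC.
Qed.

Section Map.
Variables (O P : Op K) (f : quad_hom O P).

Lemma lie_circ_map_swap :
  swap (lie_circ O) *m f = (f : 'M_(_, _)) *m swap (lie_circ P).
Proof. by rewrite /= mulNmx mulmxN hom_swap. Qed.

Lemma lie_circ_map_relator (M : free3 K (gen (lie_circ O))) :
  relator M -> relator (q := lie_circ P) (free3_map f M).
Proof.
move=> RM.
have hO := lie_circ_relator_submod O.
pose T (N : free3 K (gen P)) :=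
  exists2 M : free3 K (gen O), lie_circ_relator O M & N = free3_map f M.
have hT : is_S3_submodule (- swap P) T.
  split.
  - by exists 0; [exact: submod0 hO | rewrite free3_map0].
  - move=> k _ _ [A RA ->] [B RB ->]; exists (k *: A + B).
      exact: (submodP hO).
    by rewrite free3_mapP.
  - move=> s _ [A RA ->]; exists (act3 (- swap O) s A).
      exact: (submod_act hO).
    by apply/esym/free3_map_act; rewrite mulNmx mulmxN hom_swap.
apply: (@lie_circ_relatorP P T hT); last by exists M.
move=> V op opP; apply: cup_local_dg => // _ [A RA ->] deg x hx.
have [dO _] := lie_circ_admissible (pullback_algebra f opP).
rewrite -eval3_pullback; last exact: cup_bilin.
rewrite -(dg_rel dO RA hx); apply: eq_bigr => c _; congr (_ *: _).
by apply: eq_bigr => a _; apply: eq_bigr => b _; rewrite -!cup_pullback.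
Qed.

Definition lie_circ_map : @hom (Op K) (lie_circ O) (lie_circ P) :=
  @QuadHom K (lie_circ O) (lie_circ P) f
    lie_circ_map_swap lie_circ_map_relator.

End Map.

Definition lie_circ_functor : functor (Op K) (Op K).
Proof.
refine (@Functor (Op K) (Op K) lie_circ lie_circ_map _ _).
- by move=> P; apply: quad_hom_inj.
- by move=> P Q S g h; apply: quad_hom_inj.
Defined.

End LieCirc.

(* Main.v *)
Require Import Defs.
From mathcomp Require Import all_boot all_algebra.
From mathcomp Require Import all_fingroup boolp ring.

Set Implicit Arguments.
Unset Strict Implicit.
Unset Printing Implicit Defensive.

Import GRing.Theory.
Local Open Scope ring_scope.

(** The idea. Write an element M of the free operad in arity 3 as the sum of
    its parts of shape 0, 1 and 2, according to which input is grafted at the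
    root. Both constructions have the generators of O with the sign of the
    swap changed, and both turn out to impose the same condition on M: its
    three parts, read in the free operad on the generators of O, are congruent
    modulo the relators of O ([shapes_agree]).

    For the white product, the three trees span the arity 3 part of the free
    operad on one bracket, and the Jacobi relation is their sum. The linear
    forms on this span which kill the sum are generated by the differences of
    two coordinates; applying them to the diagonal tensor
    sum_c tree_c (x) (part of shape c) gives the differences of the parts
    ([white_lie_relatorP]).

    For the cochains, a cup bracket has values in degree 1 and depends on a
    0-cochain f only through its jump f(v_l) - f(v_r); the bracket of two
    1-cochains is 0. So a double bracket of homogeneous cochains can be
    nonzero only if exactly one input, say number i, has degree 1. The tree
    with i at the root then vanishes, because it brackets two 0-cochains
    first, and the two other trees, i + 2 and i + 1, contribute their values
    in V with opposite signs ([eval3_cup]). Hence M holds for the cup brackets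
    over all O-algebras V if and only if the difference of two of its parts
    holds in all O-algebras V, for each of the three choices of i.

    It remains to know that an element which vanishes in all O-algebras is a
    relator ([relator_complete]). This is tested on the free O-algebra on
    three generators, or rather on its quotient which keeps only the
    multilinear monomials.

    The isomorphism itself is the identification e_a |-> [-,-] (x) e_a of
    generators; it is equivariant, natural and invertible for reasons of
    linear algebra only. *)

(** * Trees of a given shape *)

Definition shape (K : fieldType) (n : nat) (M : free3 K n) (c : 'I_3) :
    free3 K n :=
  [ffun d => if d == c then M c else 0].

(** The condition on M which describes the relators of both operads. *)
Definition shapes_agree (K : fieldType) (O : quad_operad K)
    (M : free3 K (gen O)) : Prop :=
  forall c d, relator (shape M c - shape M d).

Section Submodule.
Variables (K : fieldType) (n : nat) (tau : 'M[K]_n) (R : free3 K n -> Prop).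
Hypothesis RS : is_S3_submodule tau R.

Lemma submodZ k M : R M -> R (k *: M).
Proof. by move=> RM; have := submodP RS k RM (submod0 RS); rewrite addr0. Qed.

Lemma submodD M N : R M -> R N -> R (M + N).
Proof. by move=> RM RN; have := submodP RS 1 RM RN; rewrite scale1r. Qed.

Lemma submodN M : R M -> R (- M).
Proof. by rewrite -scaleN1r; apply: submodZ. Qed.

Lemma submod_sum I (r : seq I) (F : I -> free3 K n) :
  (forall i, R (F i)) -> R (\sum_(i <- r) F i).
Proof.
move=> RF; elim/big_ind: _ => //; first exact: submod0 RS.
exact: submodD.
Qed.

End Submodule.

(** A subspace given by a mere predicate is the kernel of an endomorphism: the
    predicate is detected by a subspace of maximal dimension inside it, and
    this has a complement. It lets the arity 3 part of an operad, a quotient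
    by such a predicate, be modelled inside the free operad. *)
Lemma subspace_kernel (K : fieldType) (V : vectType K) (P : V -> Prop) :
  P 0 -> (forall (k : K) v w, P v -> P w -> P (k *: v + w)) ->
  exists p : 'End(V), forall v, P v <-> p v = 0.
Proof.
move=> P0 PD.
pose Q d := `[< exists U : {vspace V}, \dim U = d /\ forall v, v \in U -> P v >].
have exQ : exists d, Q d.
  exists 0%N; apply/asboolP; exists 0%VS; rewrite dimv0; split=> // v.
  by rewrite memv0 => /eqP->.
have Qle d : Q d -> (d <= \dim {:V})%N.
  by move=> /asboolP[U [<- _]]; apply/dimvS/subvf.
case: (ex_maxnP exQ Qle) => d /asboolP[U [dU UP]] dmax.
have PU v : P v <-> v \in U.
  split=> [Pv|]; last exact: UP.
  have UvP w : w \in (U + <[v]>)%VS -> P w.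
    case/memv_addP=> u uU [_ /vlineP[k ->] ->].
    by rewrite addrC; apply: PD => //; apply: UP.
  have := dmax (\dim (U + <[v]>)); rewrite -dU.
  have -> : Q (\dim (U + <[v]>)) by apply/asboolP; exists (U + <[v]>)%VS.
  move=> /(_ isT) le; have : (U == U + <[v]>)%VS by rewrite eqEdim addvSl.
  by move=> /eqP->; rewrite -[X in X \in _]add0r memv_add ?mem0v ?memv_line.
exists (\1 - projv U)%VF => v; rewrite PU lfunE /= id_lfunE opp_lfunE; split.
  by move=> /projv_id->; rewrite subrr.
by move/eqP; rewrite subr_eq0 => /eqP->; apply: memv_proj.
Qed.

(** Each Koszul sign has an exponent which is a sum of products of degrees of
    two different inputs. *)
Lemma koszul_eq1 (K : fieldType) deg (c i : 'I_3) :
  (forall j, j != i -> deg j = 0%N) -> koszul K deg c = 1.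
Proof.
move=> h; rewrite /koszul; have [i0|i0] := eqVneq i 0.
  rewrite (h 1) ?i0 // (h 2) ?i0 //.
  by rewrite muln0 mul0n !if_same.
have [i2|i2] := eqVneq i 2.
  rewrite (h 1) ?i2 // (h 0) ?i2 //.
  by rewrite muln0 mul0n !if_same.
by rewrite (h 0) 1?eq_sym // (h 2) 1?eq_sym // !mul0n !if_same.
Qed.

(** * Evaluation in the cup brackets *)

Section CupEvaluation.
Variables (K : fieldType) (n : nat) (V : lmodType K) (op : 'I_n -> V -> V -> V).
Hypothesis opB : forall a, is_bilinear (op a).

Lemma eval3_shape M c y :
  eval3 op (fun=> 0%N) (shape M c) y =
  \sum_a \sum_b M c a b *: op a (op b (y (c + 1)) (y (c + 2))) (y c).
Proof.
rewrite /eval3 (bigD1 c) //= (@koszul_eq1 _ _ _ 0) // scale1r.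
rewrite [X in _ + X]big1 ?addr0.
  by apply: eq_bigr => a _; apply: eq_bigr => b _; rewrite ffunE eqxx.
move=> d dc; rewrite big1 ?scaler0 // => a _; rewrite big1 // => b _.
by rewrite ffunE (negPf dc) mxE scale0r.
Qed.

Lemma ord3_cases (c j : 'I_3) : [|| j == c, j == c + 1 | j == c + 2].
Proof. by case: c => [[|[|[|]]] ?]; case: j => [[|[|[|]]] ?]. Qed.

Lemma eval3_eq0 deg M y j : y j = 0 -> eval3 op deg M y = 0.
Proof.
move=> yj; rewrite /eval3 big1 // => c _.
rewrite big1 ?scaler0 // => a _; rewrite big1 // => b _.
by case/or3P: (ord3_cases c j) => /eqP jc;
  rewrite -jc yj ?(bilin0r _ (opB _)) ?(bilin0l _ (opB _)) ?(bilin0r _ (opB _))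
    ?(bilin0l _ (opB _)) scaler0.
Qed.

(** The only datum of a 0-cochain which its bracket with a 1-cochain sees; it
    is, up to sign, the coefficient of the coboundary. *)
Definition jump (f : cochain V) : V := f VLeft - f VRight.

Lemma cup_bracket_jump a (f g : cochain V) :
  cup_brackets op a f g =
  [ffun r => if r is Edge then op a (jump f) (g Edge) - op a (f Edge) (jump g)
             else 0].
Proof.
rewrite /cup_brackets cup_bracketE; apply/ffunP=> -[]; rewrite !ffunE //.
rewrite /jump (bilinBl _ _ _ (opB _)) (bilinBr _ _ _ (opB _)) opprB.
by rewrite -!addrA; congr (_ + _); rewrite addrC [RHS]addrCA -addrA.
Qed.

Lemma cup_bracket_nested a b (f g h : cochain V) :
  cup_brackets op a (cup_brackets op b f g) h =
  [ffun r => if r is Edge then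
     op a (op b (f Edge) (jump g)) (jump h)
     - op a (op b (jump f) (g Edge)) (jump h) else 0].
Proof.
rewrite !cup_bracket_jump; apply/ffunP=> -[]; rewrite !ffunE //.
rewrite {1}/jump !ffunE subrr (bilin0l _ (opB _)) sub0r.
by rewrite (bilinBl _ _ _ (opB _)) opprB.
Qed.

(** The elements of V which remain from x when input i is used as a 1-cochain
    and the two other inputs as 0-cochains. *)
Definition spot (x : 'I_3 -> cochain V) (i j : 'I_3) : V :=
  if j == i then x j Edge else jump (x j).

(** The tree of shape c receives its 1-cochain at input c + 1 or c + 2, since
    at input c the inner bracket would be one of two 0-cochains. In these two
    cases it takes its value in V with opposite signs. Collecting the terms
    with the 1-cochain at input i leaves the trees i + 2 and i + 1. *)
Lemma eval3_cup deg M (x : 'I_3 -> cochains V) :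
  (forall c, homog (deg c) (x c)) ->
  eval3 (A := cochains V) (cup_brackets op) deg M x =
  [ffun r => if r is Edge then
     \sum_i (eval3 op (fun=> 0%N) (shape M (i + 2)) (spot x i)
             - eval3 op (fun=> 0%N) (shape M (i + 1)) (spot x i)) else 0].
Proof.
move=> hx.
pose A c i := eval3 op (fun=> 0%N) (shape M c) (spot x i).
(* Either some entry of spot x i is 0, or only input i has nonzero degree. *)
have kA c i : koszul K deg c *: A c i = A c i.
  have [[j /eqP yj]|y0] := pselect (exists j, spot x i j == 0).
    by rewrite /A (eval3_eq0 _ _ yj) scaler0.
  rewrite (@koszul_eq1 _ _ _ i) ?scale1r // => j ji.
  apply/eqP; apply: contra_notT y0 => dj; exists j.
  rewrite /spot (negPf ji) /jump.
  by have /homogE h := hx j; rewrite !h ?subrr // eq_sym.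
have ne (c : 'I_3) : (c == c + 1) = false by case: c => [[|[|[|]]]].
have ne2 (c : 'I_3) : (c == c + 2) = false by case: c => [[|[|[|]]]].
have ne12 (c : 'I_3) : (c + 1 == c + 2) = false by case: c => [[|[|[|]]]].
transitivity ([ffun r => if r is Edge then \sum_c (A c (c + 1) - A c (c + 2))
               else 0] : cochain V).
  apply/ffunP=> r; rewrite /eval3 sum_ffunE ffunE.
  transitivity (\sum_c (if r is Edge then koszul K deg c *:
      (A c (c + 1) - A c (c + 2)) else 0)); last first.
    case: r; [exact: big1 | exact: big1 |]; apply: eq_bigr => c _.
    by rewrite scalerBr !kA.
  apply: eq_bigr => c _; rewrite ffunE sum_ffunE.
  transitivity (koszul K deg c *: (if r is Edge then A c (c + 1) - A c (c + 2)
      else 0)); last by case: r; rewrite ?scaler0.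
  congr (_ *: _).
  under eq_bigr => a _.
    rewrite sum_ffunE; under eq_bigr => b _ do
      rewrite ffunE cup_bracket_nested ffunE.
  over.
  case: r; try by rewrite big1 // => a _; rewrite big1 // => b _; rewrite scaler0.
  rewrite /A !eval3_shape /= -sumrB; apply: eq_bigr => a _.
  rewrite -sumrB; apply: eq_bigr => b _; rewrite -scalerBr /spot.
  by rewrite !eqxx !ne !ne2 !ne12 eq_sym ne12.
apply/ffunP=> r; rewrite !ffunE; case: r => //.
rewrite !sumrB; congr (_ - _).
  rewrite (reindex_inj (addIr 2)) /=; apply: eq_bigr => i _.
  by congr (A _ _); rewrite -addrA [X in _ + X](_ : _ = 0) ?addr0 //; apply/val_inj.
rewrite (reindex_inj (addIr 1)) /=; apply: eq_bigr => i _.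
by congr (A _ _); rewrite -addrA [X in _ + X](_ : _ = 0) ?addr0 //; apply/val_inj.
Qed.

End CupEvaluation.

(** * The white product with Lie *)

Section WhiteLie.
Variables (K : fieldType).

Definition unit_tens n (a : 'I_n) : 'I_(1 * n) := mxtens_index (ord0, a).

(** The matrix of e_a |-> [-,-] (x) e_a. *)
Definition white_lie_mx n : 'M[K]_(n, 1 * n) := rowsub (@unit_tens n) 1%:M.

Lemma white_lie_mxE n p (A : 'M[K]_(1 * n, p)) :
  white_lie_mx n *m A = rowsub (@unit_tens n) A.
Proof. by rewrite [RHS]rowsubE. Qed.

Lemma white_lie_mx_tens m n (A : 'M[K]_(1, 1)) (B : 'M[K]_(m, n)) :
  white_lie_mx m *m (A *t B) = A 0 0 *: (B *m white_lie_mx n).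
Proof.
rewrite white_lie_mxE; apply/matrixP=> i j.
case: (mxtens_indexP j) => j0 j1.
rewrite [LHS]mxE tensmxE !ord1 [RHS]mxE; congr (_ * _); rewrite [RHS]mxE.
rewrite (bigD1 j1) //= [X in _ + X]big1 ?addr0 => [|k kj].
  by rewrite !mxE eqxx mulr1.
by rewrite !mxE (can_eq (@mxtens_indexK _ _)) xpair_eqE (negPf kj) andbF mulr0.
Qed.

Lemma white_lie_mxK n : white_lie_mx n *m (white_lie_mx n)^T = 1%:M.
Proof.
rewrite white_lie_mxE; apply/matrixP=> i j.
by rewrite !mxE (can_eq (@mxtens_indexK _ _)) xpair_eqE eqxx eq_sym.
Qed.

Lemma white_lie_mxVK n : (white_lie_mx n)^T *m white_lie_mx n = 1%:M.
Proof.
rewrite -tens1mx1; apply/matrixP=> i j.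
case: (mxtens_indexP i) => i0 i1; case: (mxtens_indexP j) => j0 j1.
rewrite tensmxE !mxE !ord1 mul1r (bigD1 i1) //= big1 ?addr0 => [|k ki].
  by rewrite !mxE !(can_eq (@mxtens_indexK _ _)) !xpair_eqE !eqxx mul1r.
by rewrite !mxE !(can_eq (@mxtens_indexK _ _)) !xpair_eqE (negPf ki) mul0r.
Qed.

Lemma free3_map_white_lie n (M : free3 K n) c :
  free3_map (white_lie_mx n) M c = (1%:M : 'M_1) *t M c.
Proof.
rewrite ffunE -[RHS]mul1mx -white_lie_mxVK -[RHS]mulmxA white_lie_mx_tens.
by rewrite mxE scale1r mulmxA.
Qed.

(** In one direction, the difference of coordinates c and d kills the Jacobi
    relation and maps the diagonal tensor to the difference of two parts of M.
    In the other direction, subtracting jacobi (x) (part of shape 0) from the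
    diagonal tensor replaces each part by its difference with part 0. *)
Lemma white_lie_relatorP (P : quad_operad K) (M : free3 K (gen P)) :
  white_relator (Lie K) P (free3_map (white_lie_mx (gen P)) M) <->
  shapes_agree M.
Proof.
have RS := relator_submod P; split=> [[s [sR Ms]] c d|hM].
  pose F (T : {ffun 'I_3 * 'I_3 -> 'M[K]_(1 * gen P)}) : free3 K (gen P) :=
    [ffun e => mxsub (@unit_tens _) (@unit_tens _) (T (c, e) - T (d, e))].
  have Fpure u v : F (pure33 u v) = (u c 0 0 - u d 0 0) *: v.
    apply/ffunP=> e; rewrite !ffunE /=; apply/matrixP=> i j.
    by rewrite !mxE !mxtens_indexK /= -mulrBl.
  have -> : shape M c - shape M d = F (diag33 (free3_map (white_lie_mx _) M)).
    have E e e' : mxsub (@unit_tens _) (@unit_tens _)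
        (if e == e' then free3_map (white_lie_mx (gen P)) M e else 0) =
        shape M e e'.
      apply/matrixP=> i j; rewrite mxE [in RHS]ffunE eq_sym.
      case: eqP => _; last by rewrite !mxE.
      by rewrite free3_map_white_lie tensmxE mxE mul1r.
    apply/ffunP=> e; transitivity (shape M c e - shape M d e).
      by rewrite !ffunE.
    rewrite -!E [RHS]ffunE ![diag33 _ _]ffunE /=.
    by apply/matrixP=> i j; rewrite !mxE.
  rewrite Ms.
  have -> : F (\sum_(uv <- s) pure33 uv.1 uv.2) =
      \sum_(uv <- s) F (pure33 uv.1 uv.2).
    apply/ffunP=> e; apply/matrixP=> i j.
    rewrite sum_ffunE summxE ffunE !sum_ffunE -sumrB mxE summxE.
    by apply: eq_bigr => uv _; rewrite [in RHS]ffunE [RHS]mxE.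
  rewrite big_seq; elim/big_rec: _ => [|uv N uvs RN]; first exact: submod0 RS.
  apply: (submodD RS) => //; rewrite Fpure.
  case: (sR _ uvs) => [[k ->]|]; last exact: (submodZ RS).
  by rewrite !ffunE subrr scale0r; apply: submod0 RS.
pose u c : free3 K 1 := [ffun e => if e == c then 1%:M else 0].
exists ((jacobi K, shape M 0) ::
  [seq (u c, shape M c - shape M 0) | c <- enum 'I_3]); split.
  move=> uv; rewrite inE => /orP[/eqP->|/mapP[c _ ->]].
    by left; exists 1; rewrite scale1r.
  by right; apply: hM.
rewrite big_cons big_map big_enum; apply/ffunP=> -[c d] /=.
rewrite [LHS]ffunE /= free3_map_white_lie [RHS]ffunE sum_ffunE (bigD1 c) //=.
rewrite [X in _ + (_ + X)]big1 ?addr0 => [|e ec].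
  rewrite !ffunE /= eqxx eq_sym; apply/matrixP=> i j.
  case: (mxtens_indexP i) => i0 i1; case: (mxtens_indexP j) => j0 j1.
  rewrite mxE !tensmxE -mulrDr !mxE !ord1 mul1r [RHS]addrC subrK.
  by case: eqP => _; rewrite ?tensmxE !mxE ?mul1r.
rewrite !ffunE /= eq_sym (negPf ec).
by apply/matrixP=> i j; rewrite !mxE mul0r.
Qed.

End WhiteLie.

(** * Operads are determined by their algebras *)

Lemma linear_comb (K : fieldType) (U W : lmodType K) (f : U -> W) :
  linear f -> forall (I : finType) (k : I -> K) (F : I -> U),
  f (\sum_i k i *: F i) = \sum_i k i *: f (F i).
Proof.
move=> fL I k F; elim/big_rec2: _ => [|i u v _ <-]; last by rewrite fL.
by have := fL (-1) 0 0; rewrite scaler0 addr0 scaleN1r addNr.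
Qed.

Section Rotations.

(** With the inputs numbered by Z/3, the six permutations are the translations
    and the reflections; a tree of shape c is moved to shape d by exactly one
    of each kind. *)
Definition rotation (j : 'I_3) : 'S_3 := perm (@addIr _ j).
Definition reflection (j : 'I_3) : 'S_3 := perm (@subrI _ j).

Lemma rotationV j c : ((rotation j)^-1)%g c = c - j.
Proof. by apply: (@perm_inj _ (rotation j)); rewrite permKV permE subrK. Qed.

Lemma reflectionV j c : ((reflection j)^-1)%g c = j - c.
Proof. by apply: (@perm_inj _ (reflection j)); rewrite permKV permE subKr. Qed.

Lemma odd_rotation j : odd_perm (rotation j) = false.
Proof.
have : (rotation j * rotation j * rotation j)%g = 1%g.
  apply/permP=> i; rewrite !permM !permE.
  by apply/val_inj; case: i => [[|[|[|]]] ?]; case: j => [[|[|[|]]] ?].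
by move/(congr1 (@odd_perm _)); rewrite !odd_permM odd_perm1; case: odd_perm.
Qed.

Lemma odd_reflection j : odd_perm (reflection j).
Proof.
have -> : reflection j = (tperm (1 : 'I_3)%R 2%R * rotation j)%g.
  apply/permP=> i; rewrite permM !permE.
  by apply/val_inj; case: i => [[|[|[|]]] ?]; case: j => [[|[|[|]]] ?].
by rewrite odd_permM odd_tperm odd_rotation.
Qed.

Lemma prod_from (R : comPzRingType) (k : 'I_3) (F : 'I_3 -> R) :
  \prod_i F i = F k * (F (k + 1) * F (k + 2)).
Proof.
rewrite (reindex_inj (addrI k)) !big_ord_recl big_ord0 /= mulr1.
congr (F _ * (F _ * F _)); last by congr (_ + _); apply/val_inj.
  by rewrite -[RHS]addr0; congr (_ + _); apply/val_inj.
by congr (_ + _); apply/val_inj.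
Qed.

End Rotations.

Section TruncatedFree.
Variables (K : fieldType) (O : quad_operad K).
Variable p : 'End({ffun 'I_3 -> 'M[K]_(gen O)}).
Local Notation n := (gen O).

(** The multilinear part of the free O-algebra on g_0, g_1, g_2: the
    generators; the products e_a (g_(c+1), g_(c+2)), recorded by a row vector
    for each c; the products of three different generators. Here p is a linear
    map with kernel the relators, so that its image models the arity 3 part of
    O. In [trunc_mul], r is the coordinate vector of any binary operation, and
    r *m swap O is its opposite. *)
Definition trunc_free : lmodType K :=
  ('rV[K]_3 * {ffun 'I_3 -> 'rV[K]_n} * free3 K n)%type.

Definition trunc_mul (r : 'rV[K]_n) (x y : trunc_free) : trunc_free :=
  (0,
   [ffun c => (x.1.1 0 (c + 1) * y.1.1 0 (c + 2)) *: r
              + (x.1.1 0 (c + 2) * y.1.1 0 (c + 1)) *: (r *m swap O)],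
   p [ffun c => y.1.1 0 c *: (r^T *m x.1.2 c)
                + x.1.1 0 c *: ((r *m swap O)^T *m y.1.2 c)]).

Lemma trunc_mul_linear x y : linear (fun r => trunc_mul r x y).
Proof.
move=> k r s; apply: injective_projections; first apply: injective_projections.
- by rewrite /= scaler0 addr0.
- apply/ffunP=> c; apply/matrixP=> i j.
  by rewrite !ffunE mulmxDl -scalemxAl !mxE; ring.
- rewrite /= -[RHS]linearP; congr (p _); apply/ffunP=> c; apply/matrixP=> i j.
  by rewrite mulmxDl -scalemxAl !ffunE !mxE !big_ord1 !mxE; ring.
Qed.

Lemma trunc_mul_bilin r : is_bilinear (trunc_mul r).
Proof.
split=> [y k x z|x k y z]; (apply: injective_projections;
  first apply: injective_projections).
- by rewrite /= scaler0 addr0.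
- by apply/ffunP=> c; apply/matrixP=> i j; rewrite !ffunE !mxE; ring.
- rewrite /= -[RHS]linearP; congr (p _); apply/ffunP=> c; apply/matrixP=> i j.
  by rewrite !ffunE !mxE !big_ord1 ?ffunE !mxE; ring.
- by rewrite /= scaler0 addr0.
- by apply/ffunP=> c; apply/matrixP=> i j; rewrite !ffunE !mxE; ring.
- rewrite /= -[RHS]linearP; congr (p _); apply/ffunP=> c; apply/matrixP=> i j.
  by rewrite !ffunE !mxE !big_ord1 ?ffunE !mxE; ring.
Qed.

Lemma trunc_mul_swap r x y : trunc_mul (r *m swap O) x y = trunc_mul r y x.
Proof.
rewrite /trunc_mul -mulmxA swapK mulmx1; congr (_, _, p _).
  by apply/ffunP=> c; rewrite !ffunE addrC ![x.1.1 0 _ * _]mulrC.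
by apply/ffunP=> c; rewrite !ffunE addrC.
Qed.

Definition trunc_op (a : 'I_n) : trunc_free -> trunc_free -> trunc_free :=
  trunc_mul (delta_mx 0 a).

(** The component c comes from evaluating the operation A in the monomials in
    which z contributes g_c; the two summands are for the two orders of the
    remaining generators among x and y. *)
Definition trunc_tree (A : 'M[K]_n) (x y z : 'rV[K]_3) : free3 K n :=
  [ffun c => (z 0 c * (x 0 (c + 1) * y 0 (c + 2))) *: A
             + (z 0 c * (x 0 (c + 2) * y 0 (c + 1))) *: (A *m swap O)].

Lemma trunc_op_nested (A : 'M[K]_n) (x y z : trunc_free) :
  \sum_a \sum_b A a b *: trunc_op a (trunc_op b x y) z =
  (0, 0, p (trunc_tree A x.1.1 y.1.1 z.1.1)).
Proof.
pose G (B : 'M[K]_n) : trunc_free :=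
  (0, 0, p (trunc_tree B x.1.1 y.1.1 z.1.1)).
have GL : linear G.
  move=> k B C; apply: injective_projections; first apply: injective_projections.
  - by rewrite /= scaler0 addr0.
  - by rewrite /= scaler0 addr0.
  - rewrite /= -[RHS]linearP; congr (p _); apply/ffunP=> c; apply/matrixP=> i j.
    by rewrite !ffunE mulmxDl -scalemxAl !mxE; ring.
have nested a b : trunc_op a (trunc_op b x y) z = G (delta_mx a b).
  congr (_, _, p _); apply/ffunP=> c; rewrite !ffunE /= !mxE.
    by rewrite !mul0r !scale0r addr0.
  rewrite scale0r addr0 trmx_delta mulmxDr -!scalemxAr mulmxA mul_delta_mx.
  by rewrite scalerDr !scalerA.
under eq_bigr => a _ do under eq_bigr => b _ do rewrite nested.
rewrite -[RHS]/(G A) [in RHS](matrix_sum_delta A) pair_bigA.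
rewrite (pair_bigA _ (fun a b => A a b *: delta_mx a b)) /=.
by rewrite (linear_comb GL).
Qed.

Lemma eval3_trunc (M : free3 K n) (x : 'I_3 -> trunc_free) :
  eval3 trunc_op (fun=> 0%N) M x =
  (0, 0, p (\sum_k trunc_tree (M k) (x (k + 1)).1.1 (x (k + 2)).1.1 (x k).1.1)).
Proof.
rewrite /eval3 linear_sum.
elim/big_rec2: _ => // k u v _ ->.
rewrite (@koszul_eq1 _ _ _ 0) // scale1r trunc_op_nested.
by apply: injective_projections; first apply: injective_projections;
  rewrite /= ?addr0.
Qed.

(** The value at (v_0, v_1, v_2) of a multilinear operation is the sum over all
    permutations s of prod_i (coefficient of g_(s i) in v_i) times its value
    at the permuted generators. *)
Lemma trunc_tree_act3 (M : free3 K n) (v : 'I_3 -> 'rV[K]_3) :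
  \sum_k trunc_tree (M k) (v (k + 1)) (v (k + 2)) (v k) =
  \sum_j (\prod_i v i 0 (rotation j i)) *: act3 (swap O) (rotation j) M
  + \sum_j (\prod_i v i 0 (reflection j i)) *: act3 (swap O) (reflection j) M.
Proof.
apply/ffunP=> c; rewrite ffunE !sum_ffunE.
under eq_bigr => k _ do rewrite ffunE.
rewrite big_split /=; congr (_ + _).
  rewrite [RHS](reindex_inj (@subrI _ c)) /=; apply: eq_bigr => k _.
  rewrite !ffunE odd_rotation mulmx1 rotationV subKr; congr (_ *: _).
  rewrite (prod_from k) !permE subrKC.
  by congr (_ * (v _ 0 _ * v _ 0 _)); rewrite addrAC subrKC addrC.
rewrite [RHS](reindex_inj (@addrI _ c)) /=; apply: eq_bigr => k _.
rewrite !ffunE odd_reflection reflectionV (addrC c k) addrK; congr (_ *: _).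
have kc : k + c - k = c by rewrite addrAC subrr add0r.
rewrite (prod_from k) !permE !opprD !addrA kc.
congr (_ * (v _ 0 _ * v _ 0 _)); rewrite -?addrA; congr (_ + _);
  exact: val_inj.
Qed.

Hypothesis pP : forall M : free3 K n, relator M <-> p M = 0.

Lemma trunc_algebra : is_algebra O trunc_op.
Proof.
split=> [a|a x y|M RM x]; first exact: trunc_mul_bilin.
  rewrite /trunc_op -trunc_mul_swap -(linear_comb (trunc_mul_linear x y)).
  congr (trunc_mul _ _ _); rewrite -rowE; apply/rowP=> j.
  rewrite mxE summxE (bigD1 j) //= big1 ?addr0 => [|b bj].
    by rewrite !mxE !eqxx mulr1.
  by rewrite !mxE eq_sym (negPf bj) mulr0.
rewrite eval3_trunc; have RS := relator_submod O.
suff /pP -> : relator (\sum_k trunc_tree (M k) (x (k + 1)).1.1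
    (x (k + 2)).1.1 (x k).1.1) by [].
rewrite (trunc_tree_act3 _ (fun k => (x k).1.1)).
by apply: (submodD RS); apply: (submod_sum RS) => j; apply: (submodZ RS);
  apply: (submod_act RS).
Qed.

Definition trunc_gen (j : 'I_3) : trunc_free := (delta_mx 0 j, 0, 0).

Lemma eval3_trunc_gen M : eval3 trunc_op (fun=> 0%N) M trunc_gen = (0, 0, p M).
Proof.
rewrite eval3_trunc; congr (_, _, p _); apply/ffunP=> c; rewrite sum_ffunE.
rewrite (bigD1 c) //= big1 ?addr0 => [|k kc]; rewrite ffunE !mxE /=.
  rewrite !eqxx !mul1r scale1r.
  suff -> : (c + 2 == c + 1) = false by rewrite mul0r scale0r addr0.
  by case: c => [[|[|[|]]] ?].
by rewrite eq_sym (negPf kc) !mul0r !scale0r addr0.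
Qed.

End TruncatedFree.

(** In the truncated free algebra, the value of M at the three generators is
    the class of M itself. *)
Lemma relator_complete (K : fieldType) (O : quad_operad K)
    (M : free3 K (gen O)) :
  (forall (V : lmodType K) (op : 'I_(gen O) -> V -> V -> V),
     is_algebra O op -> forall y, eval3 op (fun=> 0%N) M y = 0) ->
  relator M.
Proof.
move=> hM; have RS := relator_submod O.
have [p pP] := @subspace_kernel K {ffun 'I_3 -> 'M[K]_(gen O)} _
  (submod0 RS) (submodP RS).
apply/pP; have := hM _ _ (trunc_algebra pP) (@trunc_gen K O).
by rewrite eval3_trunc_gen => -[].
Qed.

(** * The two sets of relators *)

Lemma eval3B (K : fieldType) n (A : lmodType K) (op : 'I_n -> A -> A -> A)
    deg M N x :
  eval3 op deg (M - N) x = eval3 op deg M x - eval3 op deg N x.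
Proof.
by rewrite [M - N]addrC -[- N]scaleN1r eval3_linear scaleN1r addrC.
Qed.

Lemma shapes_agree_next (K : fieldType) (O : quad_operad K)
    (M : free3 K (gen O)) :
  (forall i, relator (shape M (i + 2) - shape M (i + 1))) -> shapes_agree M.
Proof.
have RS := relator_submod O.
move=> h c d; have [->|cd] := eqVneq c d.
  by rewrite subrr; apply: submod0 RS.
have : (d == c + 1) || (d == c + 2).
  by case: c cd => [[|[|[|]]] ?]; case: d => [[|[|[|]]] ?].
have [add12 add11] : c + 1 + 2 = c /\ c + 1 + 1 = c + 2.
  by split; apply/val_inj; case: c {cd} => [[|[|[|]]] ?].
have [add22 add21] : c + 2 + 2 = c + 1 /\ c + 2 + 1 = c.
  by split; apply/val_inj; case: c {cd add12 add11} => [[|[|[|]]] ?].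
case/orP=> /eqP->; last by have := h (c + 1); rewrite add12 add11.
by rewrite -opprB; apply: (submodN RS); have := h (c + 2); rewrite add22 add21.
Qed.

(** The relators of the cup brackets contain the elements with agreeing parts
    because the latter form an admissible set of relations. That this set is
    stable under S_3 is inherited from the white product. *)
Lemma lie_circ_relatorE (K : fieldType) (O : quad_operad K)
    (M : free3 K (gen O)) :
  lie_circ_relator M <-> shapes_agree M.
Proof.
split=> [RM|hM].
  (* Input i is sigma (y i) and the others are lambda (y j); so the jumps
     are y j, and [eval3_cup] keeps its term of index i only. *)
  apply: shapes_agree_next => i; apply: relator_complete => V op opP y.
  have opB := alg_bilin opP.
  pose x (j : 'I_3) : cochain V := if j == i then
    [ffun r => if r is Edge then y j else 0] else
    [ffun r => if r is VLeft then y j else 0].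
  have hx (j : 'I_3) : homog (A := cochains V) (j == i) (x j).
    by apply/homogE => r; rewrite /x; case: (j == i); case: r; rewrite ffunE.
  have [dg _] := lie_circ_admissible opP.
  have := dg_rel dg RM hx; rewrite (eval3_cup opB) // => /ffunP /(_ Edge).
  rewrite !ffunE (bigD1 i) //= [X in _ + X]big1 ?addr0 => [|k ki].
    suff spotE : spot x i = y by rewrite spotE eval3B.
    apply/funext=> j; rewrite /spot /x /jump; case: eqP => _; rewrite !ffunE //.
    by rewrite subr0.
  have xk : spot x k k = 0 by rewrite /spot eqxx /x (negPf ki) ffunE.
  by rewrite !(eval3_eq0 opB _ _ xk) subrr.
pose R (N : free3 K (gen O)) :=
  white_relator (Lie K) O (free3_map (white_lie_mx K (gen O)) N).
have WS := @white_relator_submod K (Lie K) O.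
have hR : is_S3_submodule (- swap O) R.
  split; first by rewrite /R free3_map0; apply: submod0 WS.
    by move=> k A B RA RB; rewrite /R free3_mapP; apply: (submodP WS).
  move=> s A RA; rewrite /R (@free3_map_act _ _ _ _ _ (swap (Lie K) *t swap O)).
    exact: (submod_act WS).
  by rewrite white_lie_mx_tens !mxE scaleN1r mulNmx.
apply: (@lie_circ_relatorP _ _ R hR); last exact/white_lie_relatorP.
move=> V op opP; apply: cup_local_dg => // N /white_lie_relatorP RN deg x hx.
rewrite eval3_cup //; last exact: alg_bilin opP.
apply/ffunP=> -[]; rewrite !ffunE // big1 // => i _.
by rewrite -eval3B (alg_rel opP).
Qed.

Theorem theorem2p12 (K : fieldType) :
  naturally_isomorphic (lie_circ_functor K) (white_functor (Lie K)).
Proof.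
have Ssw (O : Op K) : swap (lie_circ O) *m white_lie_mx K (gen O) =
    white_lie_mx K (gen O) *m swap (white (Lie K) O).
  by rewrite white_lie_mx_tens !mxE scaleN1r mulNmx.
have Srel (O : Op K) (M : free3 K (gen (lie_circ O))) :
    relator M -> relator (q := white (Lie K) O) (free3_map (white_lie_mx K _) M).
  by move=> /lie_circ_relatorE/white_lie_relatorP.
pose eta (O : Op K) : Defs.hom (lie_circ O) (white (Lie K) O) :=
  @QuadHom K (lie_circ O) (white (Lie K) O) _ (Ssw O) (@Srel O).
exists eta; split=> [O P f|O].
  by apply: quad_hom_inj; rewrite /= white_lie_mx_tens mxE scale1r.
have Tsw : swap (white (Lie K) O) *m (white_lie_mx K (gen O))^T =
    (white_lie_mx K (gen O))^T *m swap (lie_circ O).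
  rewrite -[LHS]mul1mx -white_lie_mxVK -mulmxA; congr (_ *m _).
  by rewrite mulmxA -Ssw -mulmxA white_lie_mxK mulmx1.
have Trel (M : free3 K (gen (white (Lie K) O))) :
    relator M -> relator (q := lie_circ O) (free3_map (white_lie_mx K _)^T M).
  move=> RM; apply/lie_circ_relatorE/white_lie_relatorP.
  by rewrite -free3_map_mul white_lie_mxVK free3_map1.
exists (@QuadHom K (white (Lie K) O) (lie_circ O) _ Tsw Trel).
by split; apply: quad_hom_inj; [exact: white_lie_mxK | exact: white_lie_mxVK].
Qed.
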